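(* Let $(X,d_X)$ be a complete separable metric space with a fixed reference point $x_*\in X$. Let $\beta\in(0,1]$ and let $L:X\to[0,1]$ be globally $\beta$-H\''older, with $K:=\operatorname{Hol}_\beta(L)<\infty$. Let $p\ge1$ and $q>p$, and set $\alpha:=\min\{\beta/p,\,1-p/q\}$. For $B\ge0$ and $\zeta\in(0,1]$ define $$\mathfrak C_q(B,\zeta;L):=\{\mu\in\mathcal P_q(X): m_q(\mu)\le B,\ \mu(L)\ge\zeta\}.$$ Then there exists $C_{\mathrm{stab}}>0$, depending on $\beta,K,p,q,B,\zeta$, such that $$W_p\bigl(\mathcal B_L(\mu),\mathcal B_L(\nu)\bigr)\le C_{\mathrm{stab}}\,W_p(\mu,\nu)^{\alpha}\qquad\text{for all }\mu,\nu\in\mathfrak C_q(B,\zeta;L).$$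
   Context: $\mathcal P(X)$ is the set of Borel probability measures on $X$. For $r\ge1$, $m_r(\mu):=\int_X d_X(x,x_* )^r\,\mu(\mathrm dx)$ and $\mathcal P_r(X):=\{\mu\in\mathcal P(X): m_r(\mu)<\infty\}$. For $\mu,\nu\in\mathcal P_p(X)$, $W_p(\mu,\nu):=\left(\inf_{\pi\in\Pi(\mu,\nu)}\int_{X\times X}d_X(x,x')^p\,\pi(\mathrm dx,\mathrm dx')\right)^{1/p}$, where $\Pi(\mu,\nu)$ is the set of couplings of $\mu$ and $\nu$. For measurable $L:X\to[0,\infty)$ (the likelihood) write $\mu(L):=\int_X L\,\mathrm d\mu$. If $0<\mu(L)<\infty$, the posterior is the probability measure $\mathcal B_L(\mu)(\mathrm dx):=\mu(L)^{-1}L(x)\,\mu(\mathrm dx)$. $\operatorname{Hol}_\beta(L):=\sup_{x\ne x'}|L(x)-L(x')|/d_X(x,x')^\beta$ (set to zero if $X$ has at most one point); $L$ is globally $\beta$-H\''older when this is finite. *)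

(* Defs.v *)
From HB Require Import structures.
From mathcomp Require Import all_boot all_order all_algebra.
From mathcomp Require Import all_classical all_reals all_analysis.
From mathcomp Require Import measurable_realfun.

Set Implicit Arguments.
Unset Strict Implicit.
Unset Printing Implicit Defensive.

Import Order.TTheory GRing.Theory Num.Theory.
Import numFieldNormedType.Exports.

Local Open Scope classical_set_scope.
Local Open Scope ring_scope.

#[short(type="completeMetricType")]
HB.structure Definition CompleteMetric (R : numDomainType) :=
  {T of CompletePseudoMetric R T & Metric R T}.

Definition separable (T : topologicalType) :=
  exists2 D : set T, countable D & dense D.

(* X as a measurable space with its Borel sigma-algebra.  The product
   [borel X * borel X] used for couplings carries the product sigma-algebra,
   which is the Borel sigma-algebra of the product when X is separable. *)
Notation borel X := (g_sigma_algebraType (@open X)).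

Section defs.
Context {R : realType} {X : completeMetricType R}.
Implicit Types (mu nu : set (borel X) -> \bar R) (L : X -> R).
Local Open Scope ereal_scope.

Definition moment (xs : X) (r : R) (mu : probability (borel X) R) : \bar R :=
  \int[mu]_x ((mdist (x : X) xs) `^ r)%:E.

Definition finite_moment (xs : X) (r : R) : set (probability (borel X) R) :=
  [set mu | moment xs r mu < +oo].

Definition coupling mu nu : set (probability (borel X * borel X)%type R) :=
  [set pi | forall A : set (borel X), measurable A ->
    pi (A `*` setT) = mu A /\ pi (setT `*` A) = nu A].

(* [mu] and [nu] are set functions so that [posterior] below can be an argument;
   a coupling can only exist when they agree with probability measures on the
   Borel sets. *)
Definition wasserstein (p : R) mu nu : \bar R :=
  (ereal_inf [set \int[pi]_z ((mdist (z.1 : X) (z.2 : X)) `^ p)%:E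
             | pi in coupling mu nu]) `^ (p^-1).

Definition evidence L (mu : probability (borel X) R) : \bar R :=
  \int[mu]_x (L x)%:E.

Definition posterior L (mu : probability (borel X) R)
    (A : set (borel X)) : \bar R :=
  (fine (evidence L mu))^-1%:E * \int[mu]_(x in A) (L x)%:E.

(* The point 0 implements the convention that the supremum is 0 on a space with
   at most one point; it is harmless since the quotients are nonnegative. *)
Definition holder_seminorm (beta : R) L : \bar R :=
  ereal_sup ([set 0] `|`
    [set ((`|L xy.1 - L xy.2| / (mdist xy.1 xy.2) `^ beta)%R)%:E
    | xy in [set xy : X * X | xy.1 <> xy.2]]).

Definition stability_class (xs : X) (q B zeta : R) L :
    set (probability (borel X) R) :=
  [set mu | [/\ finite_moment xs q mu, moment xs q mu <= B%:E
              & zeta%:E <= evidence L mu]].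

Lemma posterior_probability L (mu : probability (borel X) R) :
  measurable_fun [set: borel X] (L : borel X -> R) ->
  (forall x, 0 <= L x)%R -> 0 < evidence L mu < +oo ->
  exists P : probability (borel X) R, (P : set (borel X) -> \bar R) = posterior L mu.
Proof.
move=> mL L0 /andP[Z0 Zoo].
have Zfin : evidence L mu \is a fin_num by rewrite ge0_fin_numE// ltW.
have mE : measurable_fun [set: borel X] (EFin \o (L : borel X -> R)).
  exact/measurable_EFinP.
have E0 (x : borel X) : 0 <= (EFin \o (L : borel X -> R)) x by rewrite lee_fin.
have P0 : posterior L mu set0 = 0.
  by rewrite /posterior integral_set0 mule0.
have c0 : 0 <= (fine (evidence L mu))^-1%:E.
  by rewrite lee_fin invr_ge0 fine_ge0// ltW.
have Pge0 A : 0 <= posterior L mu A.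
  by apply: mule_ge0 => //; apply: integral_ge0 => x _; exact: E0.
have Psigma : semi_sigma_additive (posterior L mu).
  move=> F mF tF mUF.
  rewrite [X in X @ _ --> _](_ : _ = fun n : nat =>
      (fine (evidence L mu))^-1%:E *
      \sum_(0 <= i < n) \int[mu]_(x in F i) (L x)%:E); last first.
    by apply/funext => n; rewrite -ge0_sume_distrr// => i _; apply: integral_ge0 => x _; exact: E0.
  apply: cvgeZl => //.
  exact: (semi_sigma_additive_nng_induced mE E0 mF tF mUF).
pose M0 := isMeasure.Build _ _ _ (posterior L mu) P0 Pge0 Psigma.
pose M : {measure set (borel X) -> \bar R} := HB.pack (posterior L mu) M0.
have P1 : M setT = 1.
  rewrite /= /posterior -/(evidence L mu) -{2}(fineK Zfin) -EFinM mulVf//.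
  by rewrite gt_eqF// fine_gt0// Z0.
pose Q0 := Measure_isProbability.Build _ _ _ M P1.
pose Q : probability (borel X) R := HB.pack (posterior L mu) M0 Q0.
by exists Q.
Qed.

End defs.

(* Main.v *)
Require Import Defs.
From HB Require Import structures.
From mathcomp Require Import all_boot all_order all_algebra.
From mathcomp Require Import all_classical all_reals all_analysis.
From mathcomp Require Import measurable_realfun.
From mathcomp Require Import ring lra.

(** Let [pi] be any coupling of [mu] and [nu], and let [f = L / mu(L)] and
    [g = L / nu(L)] be the densities of the posteriors.  A coupling of the
    posteriors is obtained by keeping the common part [min (f x) (g y)] of the
    two densities on [pi], and by joining the two residual marginals, which
    have the same mass, by their normalized product ([overlap_coupling]).  The
    kept part costs at most [zeta^-1] times the cost of [pi].  The residual
    part may travel far, but a displacement from [x] to [y] is at most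
    [2 ^ p * (d(x, xs) ^ p + d(y, xs) ^ p)] once raised to the power [p], so
    that its cost is an integral against [pi] of the [p]-th moments weighted by
    [|f x - g y|].

    The exponent [a = min (beta / p) (1 - p / q)] comes from not separating the
    moment from the weight.  Bounding the residual mass first and interpolating
    its [p]-th moment afterwards would only give the product of the two
    exponents.  Instead, with [d = d(x, y)], the weight is at most
    [C * (d ^ (p * a) + int d ^ (p * a) dpi)], because [L] is Hoelder, bounded,
    and [p * a <= beta].  It then remains to bound the integral of
    [d ^ (p * a) * (1 + d(x, xs) ^ p + d(y, xs) ^ p)].  If
    [int d ^ p dpi <= eps ^ p], rescale by [w = d / eps]: since
    [p / q + a <= 1], the geometric mean [u ^ p * w ^ (p * a)] of [u ^ q],
    [w ^ p] and [1] is at most their sum, and that sum has a bounded integral.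
    All the terms are therefore dominated pointwise by [eps ^ (p * a)] times a
    single function, [envelope], whose integral against [pi] is at most
    [6 + 2 * B] ([overlap_cost_le], [integral_envelope]).  So [mu] and [nu]
    being [eps]-close makes the posteriors [C * eps ^ a]-close
    ([posterior_coupling]), and [eps] can decrease to the distance of [mu] and
    [nu] ([le_powR_of_gt]). *)

Set Implicit Arguments.
Unset Strict Implicit.
Unset Printing Implicit Defensive.

Import Order.TTheory GRing.Theory Num.Theory.
Import numFieldNormedType.Exports.

Local Open Scope classical_set_scope.
Local Open Scope ring_scope.

(** * Inequalities between real powers *)
Section real_powers.
Context {R : realType}.
Implicit Types x y a b C w : R.

Lemma powRVK x a : 0 <= x -> a != 0 -> (x `^ a^-1) `^ a = x.
Proof. by move=> x0 a0; rewrite -powRrM mulVf// powRr1. Qed.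

(** A weighted geometric mean of [x], [y] and [1] is at most their maximum, hence
    at most their sum.  This replaces both Hoelder's and Jensen's inequality in the estimates below. *)
Lemma powR_mul_le x y a b : 0 <= x -> 0 <= y -> 0 <= a -> 0 <= b ->
  a + b <= 1 -> x `^ a * y `^ b <= 1 + x + y.
Proof.
move=> x0 y0 a0 b0 ab.
have M1 : 1 <= 1 + x + y by lra.
have M0 : 0 <= 1 + x + y by lra.
have xM : x `^ a <= (1 + x + y) `^ a.
  by apply: ge0_ler_powR => //; rewrite ?nnegrE//; lra.
have yM : y `^ b <= (1 + x + y) `^ b.
  by apply: ge0_ler_powR => //; rewrite ?nnegrE//; lra.
apply: (le_trans (ler_pM (powR_ge0 _ _) (powR_ge0 _ _) xM yM)).
rewrite -powRD; last by apply/implyP => _; rewrite gt_eqF//; lra.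
exact: ler1_powR.
Qed.

Lemma powR_le_1D x a : 0 <= x -> 0 <= a -> a <= 1 -> x `^ a <= 1 + x.
Proof.
move=> x0 a0 a1.
have := @powR_mul_le x 0 a 0 x0 (lexx _) a0 (lexx _).
by rewrite powRr0 mulr1 addr0 addr0; apply.
Qed.

Lemma powRD_le x y a : 0 <= x -> 0 <= y -> 0 <= a ->
  (x + y) `^ a <= 2 `^ a * (x `^ a + y `^ a).
Proof.
move=> x0 y0 a0.
wlog xy : x y x0 y0 / x <= y.
  move=> H; have [/H|/ltW/H] := leP x y; first exact.
  by rewrite addrC (addrC (_ `^ a)); apply.
apply: (@le_trans _ _ ((2 * y) `^ a)).
  by apply: ge0_ler_powR => //; rewrite ?nnegrE//; lra.
by rewrite powRM// ler_pM2l ?powR_gt0// lerDr powR_ge0.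
Qed.

(** Right-continuity of [e |-> C * e `^ a]: if the bound failed at [w], it
    would fail midway between [w] and the point where this function reaches
    [x]. *)
Lemma le_powR_of_gt C a w x : 0 < C -> 0 < a -> 0 <= w -> 0 <= x ->
  (forall e, w < e -> x <= C * e `^ a) -> x <= C * w `^ a.
Proof.
move=> C0 a0 w0 x0 H; rewrite leNgt; apply/negP => lt_x.
have xC0 : 0 <= x / C by rewrite divr_ge0// ltW.
have rootK := powRVK xC0 (lt0r_neq0 a0).
have wt : w < (x / C) `^ a^-1.
  rewrite ltNge; apply/negP => le_w.
  have : ((x / C) `^ a^-1) `^ a <= w `^ a.
    by apply: ge0_ler_powR => //; rewrite ?nnegrE ?powR_ge0// ltW.
  by rewrite rootK ler_pdivrMr// mulrC leNgt lt_x.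
have := H _ (midf_lt wt).1; apply/negP; rewrite -ltNge.
rewrite mulrC -ltr_pdivlMr// -[ltRHS]rootK.
apply: gt0_ltr_powR => //; rewrite ?nnegrE ?powR_ge0//; last exact: (midf_lt wt).2.
by rewrite divr_ge0// addr_ge0// powR_ge0.
Qed.

End real_powers.

(** * Borel measurability in a separable metric space *)

Section borel_measurability.
Context {R : realType} {X : completeMetricType R}.
Implicit Types x y : X.

Lemma holder_measurable (K b : R) (f : X -> R) : 0 <= K -> 0 < b ->
  (forall x y, `|f x - f y| <= K * mdist x y `^ b) ->
  measurable_fun [set: borel X] (f : borel X -> R).
Proof.
move=> K0 b0 hf.
apply: (measurability _ (RGenInftyO.measurableE R)) => //.
move=> _ [_ [r ->] <-]; rewrite setTI; apply: sub_sigma_algebra.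
rewrite openE => x /=; rewrite in_itv/= => fxr.
have K1 : 0 < K + 1 by rewrite ltr_wpDl.
have e0 : 0 < (r - f x) / (K + 1) by rewrite divr_gt0// subr_gt0.
have d0 : 0 < ((r - f x) / (K + 1)) `^ b^-1 by rewrite powR_gt0.
apply: (filterS _ (nbhsx_ballx x _ d0)) => y; rewrite ballEmdist /= in_itv/= => xy.
have : mdist x y `^ b < (r - f x) / (K + 1).
  rewrite -[ltRHS](powRVK (ltW e0) (lt0r_neq0 b0)).
  by apply: gt0_ltr_powR => //; rewrite nnegrE ?mdist_ge0// ltW.
rewrite ltr_pdivlMr// => dlt.
have := hf x y; rewrite ler_norml => /andP[+ _].
have := powR_ge0 (mdist x y) b.
nra.
Qed.

Lemma mdist_measurable x :
  measurable_fun [set: borel X] (fun y : borel X => mdist (y : X) x).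
Proof.
apply: (@holder_measurable 1 1) => // y z.
rewrite mul1r powRr1 ?mdist_ge0// ler_norml.
have := metric_triangle y z x; have := metric_triangle z y x.
rewrite (metric_sym z y); lra.
Qed.

(** The sigma-algebra on pairs is the product one, for which continuity of the
    distance gives nothing.  Separability writes [d(x, y) < r] as a countable
    union of rectangles: some point of a dense sequence is within a rational
    [s] of [x] and within [r - s] of [y]. *)
Lemma separable_mdist_measurable : separable X ->
  measurable_fun [set: (borel X * borel X)%type]
    (fun z : borel X * borel X => mdist (z.1 : X) (z.2 : X)).
Proof.
move=> [D /pcard_surjP[g gD] dD].
have mball x (r : R) :
    measurable ([set y | mdist (y : X) x < r] : set (borel X)).
  have -> : ([set y | mdist (y : X) x < r] : set (borel X)) =
      setT `&` (fun y : borel X => mdist (y : X) x) @^-1` `]-oo, r[.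
    by rewrite setTI; apply/seteqP; split => y /=; rewrite in_itv.
  exact: (mdist_measurable x).
apply: (measurability _ (RGenInftyO.measurableE R)) => //.
move=> _ [_ [r ->] <-]; rewrite setTI.
have -> : (fun z : borel X * borel X => mdist (z.1 : X) (z.2 : X)) @^-1`
    `]-oo, r[ =
   \bigcup_(n : nat) \bigcup_(s : rat)
      ([set y : borel X | mdist (y : X) (g n) < ratr s] `*`
       [set y : borel X | mdist (y : X) (g n) < r - ratr s]).
  apply/seteqP; split => [[x y]/=|[x y] [n _] [s _] [/= xs ys]]; rewrite in_itv/=.
    move=> xyr.
    (* half of the slack pays for the distance from x to the dense point, the
       other half for the rational s *)
    have e0 : 0 < (r - mdist (x : X) (y : X)) / 2 by rewrite divr_gt0// subr_gt0.
    have [] := dD (ball (x : X) ((r - mdist (x : X) (y : X)) / 2))°.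
    - exists (x : X); exact: nbhsx_ballx.
    - exact: open_interior.
    move=> a [/interior_subset + Da]; rewrite ballEmdist/= => xa.
    have [n _ na] := gD _ Da.
    have /rat_in_itvoo[s] := xa; rewrite in_itv/= => /andP[s1 s2].
    exists n => //; exists s => //; split => /=; rewrite na//.
    have := metric_triangle (y : X) x a.
    rewrite (metric_sym (y : X) x); lra.
  have := metric_triangle (x : X) (g n) (y : X).
  rewrite (metric_sym (g n)); lra.
apply: bigcup_measurable => n _; apply: bigcupT_measurable_rat => s.
exact: measurableX.
Qed.

End borel_measurability.

(** * Densities and products of finite measures *)

Section densities.
Context d (T : measurableType d) (R : realType).
Variable m : {measure set T -> \bar R}.
Local Open Scope ereal_scope.

Import HBNNSimple.

(** The defining formula on indicators extends to simple functions by linearity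
    and to all nonnegative functions by monotone convergence. *)
Lemma density_measure (g : T -> R) : measurable_fun [set: T] g ->
  (forall x, (0 <= g x)%R) ->
  exists nu : {measure set T -> \bar R},
    forall f : T -> \bar R, measurable_fun [set: T] f -> (forall x, 0 <= f x) ->
      \int[nu]_x f x = \int[m]_x (f x * (g x)%:E).
Proof.
move=> mg g0.
have mG : measurable_fun [set: T] (EFin \o g) by exact/measurable_EFinP.
have G0 x : 0 <= (EFin \o g) x by rewrite lee_fin.
pose n0 (A : set T) := \int[m]_(x in A) (EFin \o g) x.
have n00 : n0 set0 = 0 by rewrite /n0 integral_set0.
have n0ge0 A : 0 <= n0 A by apply: integral_ge0 => x _; exact: G0.
have n0sigma : semi_sigma_additive n0.
  exact: semi_sigma_additive_nng_induced.
pose M := isMeasure.Build _ _ _ n0 n00 n0ge0 n0sigma.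
pose nu : {measure set T -> \bar R} := HB.pack n0 M.
exists nu => f mf f0.
pose h := nnsfun_approx measurableT mf.
have hx x : (EFin \o h ^~ x) n @[n --> \oo] --> f x.
  by apply: cvg_nnsfun_approx.
have mh n : measurable_fun [set: T] (EFin \o h n) by exact/measurable_EFinP.
have gE0 x : 0 <= (g x)%:E by rewrite lee_fin.
have h0 n x : 0 <= (EFin \o h n) x by rewrite lee_fin.
transitivity (limn (fun n => \int[nu]_x (EFin \o h n) x)).
  rewrite -monotone_convergence//.
  - by apply: eq_integral => x _; apply/esym/cvg_lim => //; exact: hx.
  - by move=> x _ a b ab; rewrite lee_fin; exact/lefP/nd_nnsfun_approx.
transitivity (limn (fun n => \int[m]_x ((EFin \o h n) x * (g x)%:E))); last first.
  rewrite -monotone_convergence//.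
  - apply: eq_integral => x _; apply/cvg_lim => //.
    by apply: cvgeZr => //; exact: (hx x).
  - by move=> n; exact: (emeasurable_funM (mh n) mG).
  - by move=> n x _; rewrite mule_ge0.
  - move=> x _ a b ab; rewrite lee_wpmul2r// lee_fin.
    exact/lefP/nd_nnsfun_approx.
congr (limn _); apply/funext => n.
have ind_ge0 r x : 0 <= (r * \1_(h n @^-1` [set r]) x)%:E.
  by rewrite EFinM nnfun_muleindic_ge0.
have mind r : measurable_fun [set: T] (fun x => (r * \1_(h n @^-1` [set r]) x)%:E).
  exact/measurable_EFinP/measurable_funM.
transitivity (\int[nu]_x
   (\sum_(r \in range (h n)) (r * \1_(h n @^-1` [set r]) x)%:E)).
  by apply: eq_integral => x _; rewrite /= fimfunE -fsumEFin.
rewrite ge0_integral_fsum//.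
transitivity (\int[m]_x
   (\sum_(r \in range (h n)) (r * \1_(h n @^-1` [set r]) x)%:E * (g x)%:E)); last first.
  apply: eq_integral => x _.
  by rewrite -ge0_mule_fsuml// fsumEFin// -fimfunE.
rewrite ge0_integral_fsum//; last 2 first.
- by move=> r; exact: (emeasurable_funM (mind r) mG).
- by move=> r x _; rewrite mule_ge0.
apply: eq_fsbigr => r _.
under eq_integral do rewrite EFinM.
rewrite integralZl_indic_nnsfun// integral_indic// setIT.
under [RHS]eq_integral do rewrite EFinM -muleA.
have [r0|r0] := leP 0%R r; last first.
  have h_r : h n @^-1` [set r] = set0 by exact: preimage_nnfun0.
  rewrite h_r measure0 mule0 integral0_eq// => x _.
  by rewrite indic0 mul0e mule0.
rewrite ge0_integralZl//; last 2 first.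
- by apply: emeasurable_funM => //; exact/measurable_EFinP.
- by move=> x _; rewrite mule_ge0// lee_fin.
congr (_ * _); rewrite -[LHS]/(\int[m]_(x in h n @^-1` [set r]) (EFin \o g) x).
rewrite integral_mkcond; apply: eq_integral => x _.
by rewrite epatch_indic muleC.
Qed.

End densities.

Section independent_coupling.
Context d1 d2 (T1 : measurableType d1) (T2 : measurableType d2) (R : realType).
Local Open Scope ereal_scope.

(** Two finite measures of equal mass [D] are coupled by their product divided
    by [D].  Dividing by [D] also makes costs of the form [h1 x + h2 y] split
    into integrals against the marginals.  If [D] is zero, both measures vanish
    and the zero measure couples them. *)
Lemma normalized_product (a : {finite_measure set T1 -> \bar R})
    (b : {finite_measure set T2 -> \bar R}) : a setT = b setT ->
  exists rho : {measure set (T1 * T2)%type -> \bar R},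
  [/\ forall A, measurable A -> rho (A `*` setT) = a A,
      forall B, measurable B -> rho (setT `*` B) = b B &
      forall (G : T1 * T2 -> \bar R) (h1 : T1 -> \bar R) (h2 : T2 -> \bar R),
        measurable_fun setT G -> measurable_fun setT h1 -> measurable_fun setT h2 ->
        (forall z, 0 <= G z) -> (forall x, 0 <= h1 x) -> (forall y, 0 <= h2 y) ->
        (forall x y, G (x, y) <= h1 x + h2 y) ->
        \int[rho]_z G z <= \int[a]_x h1 x + \int[b]_y h2 y].
Proof.
move=> ab.
have afin : a setT \is a fin_num by exact: fin_num_measure.
pose D := fine (a setT).
have D0 : (0 <= D)%R by rewrite fine_ge0.
have aE : a setT = D%:E by rewrite fineK.
have bE : b setT = D%:E by rewrite -ab.
have iD0 : (0 <= D^-1)%R by rewrite invr_ge0.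
have DK (x : \bar R) : 0 <= x <= D%:E -> (D^-1)%:E * (x * D%:E) = x.
  move=> /andP[x0 xD].
  have xfin : x \is a fin_num by rewrite ge0_fin_numE// (le_lt_trans xD)// ltry.
  move: x0 xD; rewrite -(fineK xfin) !lee_fin => x0 xD.
  rewrite -!EFinM; congr EFin.
  have [D_0|D_n0] := eqVneq D 0%R; last by rewrite mulrC mulfK.
  by apply/eqP; rewrite D_0 mulr0 mulr0 eq_le x0 -D_0 xD.
pose rho : {measure set (T1 * T2)%type -> \bar R} := mscale (NngNum iD0) (a \x b).
have rhoE A B : measurable A -> measurable B ->
    rho (A `*` B) = (D^-1)%:E * (a A * b B).
  by move=> mA mB; rewrite -product_measure1E.
exists rho; split.
- move=> A mA; rewrite rhoE// bE DK//.
  by rewrite measure_ge0/= -aE le_measure ?inE.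
- move=> B mB; rewrite rhoE// aE (muleC D%:E) DK//.
  by rewrite measure_ge0/= -bE le_measure ?inE.
- move=> G h1 h2 mG mh1 mh2 G0 h10 h20 Gh.
  have mh : measurable_fun setT (fun z : T1 * T2 => h1 z.1 + h2 z.2).
    by apply: emeasurable_funD; exact: measurableT_comp.
  have h0 (z : T1 * T2) : 0 <= h1 z.1 + h2 z.2 by rewrite adde_ge0.
  have i1 : 0 <= \int[a]_x h1 x by exact: integral_ge0.
  have i2 : 0 <= \int[b]_y h2 y by exact: integral_ge0.
  have GI : \int[a \x b]_z G z <= (\int[a]_x h1 x + \int[b]_y h2 y) * D%:E.
    apply: (@le_trans _ _ (\int[a \x b]_z (h1 z.1 + h2 z.2))).
      by apply: ge0_le_integral => // -[x y] _; exact: Gh.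
    rewrite fubini_tonelli1//.
    rewrite (@eq_integral _ _ _ _ _ (fun x => h1 x * D%:E + \int[b]_y h2 y)); last first.
      move=> x _; rewrite /fubini_F/= ge0_integralD//.
      by rewrite integral_cst//; congr (_ * _ + _); exact: bE.
    rewrite ge0_integralD//; last 2 first.
    - by move=> x _; rewrite mule_ge0.
    - exact: emeasurable_funM.
    rewrite ge0_integralZr// integral_cst// [X in _ + _ * X](_ : _ = D%:E)// -muleDl//.
    exact: ge0_adde_def.
  rewrite ge0_integral_mscale//=.
  apply: (@le_trans _ _ ((D^-1)%:E * ((\int[a]_x h1 x + \int[b]_y h2 y) * D%:E))).
    by rewrite lee_wpmul2l.
  rewrite muleCA -EFinM -[leRHS]mule1; apply: lee_wpmul2l; first exact: adde_ge0.
  rewrite lee_fin; have [->|Dn0] := eqVneq D 0%R; first by rewrite mulr0.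
  by rewrite mulVf.
Qed.

End independent_coupling.

(** * Coupling two densities along their overlap *)

Section overlap_coupling.
Local Open Scope ereal_scope.

Lemma finite_measure_of d (T : measurableType d) (R : realType)
    (m : {measure set T -> \bar R}) : m setT < +oo ->
  exists n : {finite_measure set T -> \bar R}, (n : set T -> \bar R) = m.
Proof.
suff build (k : set T -> \bar R) : k set0 = 0 -> (forall A, 0 <= k A) ->
    semi_sigma_additive k -> k setT < +oo ->
    exists n : {finite_measure set T -> \bar R}, (n : set T -> \bar R) = k.
  exact: build (measure0 m) (measure_ge0 m) (@measure_semi_sigma_additive _ _ _ m).
move=> k0 k_ge0 k_additive koo.
pose mk := isMeasure.Build _ _ _ k k0 k_ge0 k_additive.
pose M : {measure set T -> \bar R} := HB.pack k mk.
have koo' : M setT < +oo by [].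
pose fk := Measure_isFinite.Build _ _ _ M (lty_fin_num_fun koo').
pose n : {finite_measure set T -> \bar R} := HB.pack k mk fk.
by exists n.
Qed.

Lemma probability_of d (T : measurableType d) (R : realType)
    (m : {measure set T -> \bar R}) : m setT = 1 ->
  exists P : probability T R, (P : set T -> \bar R) = m.
Proof.
suff build (k : set T -> \bar R) : k set0 = 0 -> (forall A, 0 <= k A) ->
    semi_sigma_additive k -> k setT = 1 ->
    exists n : probability T R, (n : set T -> \bar R) = k.
  exact: build (measure0 m) (measure_ge0 m) (@measure_semi_sigma_additive _ _ _ m).
move=> k0 k_ge0 k_additive k1.
pose mk := isMeasure.Build _ _ _ k k0 k_ge0 k_additive.
pose M : {measure set T -> \bar R} := HB.pack k mk.
pose pk := Measure_isProbability.Build _ _ _ M k1.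
pose P : probability T R := HB.pack k mk pk.
by exists P.
Qed.

(** The image under [phi] of the measure of density [g], characterized by its
    integrals: this is the form in which marginals of a weighted coupling are
    used. *)
Lemma weighted_image d1 d2 (T1 : measurableType d1) (T2 : measurableType d2)
    (R : realType) (m : {measure set T1 -> \bar R}) (phi : T1 -> T2) (g : T1 -> R) :
  measurable_fun [set: T1] phi -> measurable_fun [set: T1] g ->
  (forall x, (0 <= g x)%R) -> \int[m]_x (g x)%:E < +oo ->
  exists n : {finite_measure set T2 -> \bar R},
    forall f : T2 -> \bar R, measurable_fun [set: T2] f -> (forall y, 0 <= f y) ->
      \int[n]_y f y = \int[m]_x (f (phi x) * (g x)%:E).
Proof.
move=> mphi mg g0 goo.
have [nu nuE] := density_measure m mg g0.
pose push := (pushforward nu phi : {measure set T2 -> \bar R}).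
pose n0 : {measure set T2 -> \bar R} := push mphi.
have n0T : n0 setT < +oo.
  rewrite -[ltLHS]/(nu (phi @^-1` setT)) preimage_setT.
  rewrite -[ltLHS]mul1e -integral_cst// nuE//.
  by under eq_integral do rewrite mul1e.
have [n nE] := finite_measure_of n0T.
exists n => f mf f0.
rewrite nE -[LHS]/(\int[pushforward nu phi]_y f y) ge0_integral_pushforward//.
rewrite preimage_setT.
exact: (nuE (f \o phi) (measurableT_comp mf mphi) (fun x => f0 _)).
Qed.

Context d1 d2 (T1 : measurableType d1) (T2 : measurableType d2) (R : realType).
Variable pi : probability (T1 * T2)%type R.
Variables (f : T1 -> R) (g : T2 -> R).
Hypotheses (mf : measurable_fun [set: T1] f) (mg : measurable_fun [set: T2] g).
Hypotheses (f0 : forall x, (0 <= f x)%R) (g0 : forall y, (0 <= g y)%R).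
Hypotheses (f1 : \int[pi]_z (f z.1)%:E = 1) (g1 : \int[pi]_z (g z.2)%:E = 1).

(** [rho] is the sum of the measure of density [min f g] with respect to [pi]
    and of the normalized product of the marginals of [(f - min f g) pi] and
    [(g - min f g) pi].  These have the same mass because [f] and [g] both
    integrate to [1].  Since one of the two residual densities vanishes at each
    pair, both are at most [|f - g|]. *)
Lemma overlap_coupling : exists rho : probability (T1 * T2)%type R,
  [/\ forall A, measurable A -> rho (A `*` setT) = \int[pi]_z (\1_A z.1 * f z.1)%:E,
      forall A, measurable A -> rho (setT `*` A) = \int[pi]_z (\1_A z.2 * g z.2)%:E &
      forall (G : T1 * T2 -> R) (h1 : T1 -> R) (h2 : T2 -> R),
        measurable_fun setT G -> measurable_fun setT h1 -> measurable_fun setT h2 ->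
        (forall z, 0 <= G z)%R -> (forall x, 0 <= h1 x)%R -> (forall y, 0 <= h2 y)%R ->
        (forall x y, G (x, y) <= h1 x + h2 y)%R ->
        \int[rho]_z (G z)%:E <= \int[pi]_z
          (G z * Num.min (f z.1) (g z.2) +
           (h1 z.1 + h2 z.2) * `|f z.1 - g z.2|)%:E].
Proof.
pose F (z : T1 * T2) := f z.1.
pose H (z : T1 * T2) := g z.2.
pose o (z : T1 * T2) := Num.min (F z) (H z).
have mF : measurable_fun setT F by exact: measurableT_comp.
have mH : measurable_fun setT H by exact: measurableT_comp.
have mo : measurable_fun setT o by exact: measurable_minr.
have o0 z : (0 <= o z)%R by rewrite /o le_min f0 g0.
have mr1 : measurable_fun setT (fun z => F z - o z)%R by exact: measurable_funB.
have mr2 : measurable_fun setT (fun z => H z - o z)%R by exact: measurable_funB.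
have r10 z : (0 <= F z - o z)%R by rewrite subr_ge0 ge_min lexx.
have r20 z : (0 <= H z - o z)%R by rewrite subr_ge0 ge_min lexx orbT.
have lty_of_le (k l : T1 * T2 -> R) :
    measurable_fun setT k -> measurable_fun setT l ->
    (forall z, 0 <= k z)%R -> (forall z, k z <= l z)%R -> \int[pi]_z (l z)%:E = 1 ->
    \int[pi]_z (k z)%:E < +oo.
  move=> mk ml k0 kl l1; apply: (@le_lt_trans _ _ 1); last exact: ltry.
  rewrite -l1; apply: ge0_le_integral => //; try exact/measurable_EFinP.
  - by move=> z _; rewrite lee_fin.
  - by move=> z _; rewrite lee_fin.
have [nm nmE] := @weighted_image _ _ _ _ _ pi id o (@measurable_id _ _ _) mo o0
  (lty_of_le _ _ mo mF o0 (fun z => ltac:(by rewrite ge_min lexx)) f1).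
have [a aE] := @weighted_image _ _ _ _ _ pi fst _ (@measurable_fst _ _ _ _) mr1 r10
  (lty_of_le _ _ mr1 mF r10 (fun z => ltac:(by rewrite lerBlDr lerDl)) f1).
have [b bE] := @weighted_image _ _ _ _ _ pi snd _ (@measurable_snd _ _ _ _) mr2 r20
  (lty_of_le _ _ mr2 mH r20 (fun z => ltac:(by rewrite lerBlDr lerDl)) g1).
have indE d (T : measurableType d) (n : {measure set T -> \bar R}) A :
    measurable A -> n A = \int[n]_x (\1_A x)%:E.
  by move=> mA; rewrite integral_indic// setIT.
have mI d (T : measurableType d) (A : set T) : measurable A ->
    measurable_fun setT (fun x => (\1_A x)%:E : \bar R).
  by move=> mA; exact/measurable_EFinP.
have I0 T (A : set T) x : 0 <= (\1_A x)%:E :> \bar R by rewrite lee_fin.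
have split1 (k r s : T1 * T2 -> R) :
    measurable_fun setT k -> measurable_fun setT r -> measurable_fun setT s ->
    (forall z, 0 <= k z)%R -> (forall z, 0 <= r z)%R -> (forall z, 0 <= s z)%R ->
    \int[pi]_z ((k z)%:E * (r z)%:E) + \int[pi]_z ((k z)%:E * (s z)%:E) =
    \int[pi]_z (k z * (r z + s z))%:E.
  move=> mk mr ms k0 r0 s0; rewrite -ge0_integralD//; last 4 first.
  - by move=> z _; rewrite mule_ge0 ?lee_fin.
  - by apply: emeasurable_funM; exact/measurable_EFinP.
  - by move=> z _; rewrite mule_ge0 ?lee_fin.
  - by apply: emeasurable_funM; exact/measurable_EFinP.
  by apply: eq_integral => z _; rewrite -!EFinM -EFinD mulrDr.
have aI A : measurable A -> a A = \int[pi]_z ((\1_A z.1)%:E * (F z - o z)%:E).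
  by move=> mA; rewrite indE// aE//; exact: mI.
have bI A : measurable A -> b A = \int[pi]_z ((\1_A z.2)%:E * (H z - o z)%:E).
  by move=> mA; rewrite indE// bE//; exact: mI.
have nI A : measurable A -> nm A = \int[pi]_z ((\1_A z)%:E * (o z)%:E).
  by move=> mA; rewrite indE// nmE//; exact: mI.
have m1 (A : set T1) : measurable A ->
    measurable_fun setT (fun z : T1 * T2 => \1_A z.1 : R).
  by move=> mA; exact: measurableT_comp.
have m2 (A : set T2) : measurable A ->
    measurable_fun setT (fun z : T1 * T2 => \1_A z.2 : R).
  by move=> mA; exact: measurableT_comp.
have na A : measurable A -> nm (A `*` setT) + a A = \int[pi]_z (\1_A z.1 * f z.1)%:E.
  move=> mA; rewrite nI ?aI//; last exact: measurableX.
  rewrite -[X in X + _]/(\int[pi]_z ((\1_(A `*` setT) z)%:E * (o z)%:E)).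
  under eq_integral do rewrite indicE in_setX in_setT andbT -indicE.
  rewrite split1//; last exact: m1.
  by apply: eq_integral => z _; rewrite addrC subrK.
have nb A : measurable A -> nm (setT `*` A) + b A = \int[pi]_z (\1_A z.2 * g z.2)%:E.
  move=> mA; rewrite nI ?bI//; last exact: measurableX.
  under eq_integral do rewrite indicE in_setX in_setT andTb -indicE.
  rewrite split1//; last exact: m2.
  by apply: eq_integral => z _; rewrite addrC subrK.
have n1 : nm setT + a setT = 1.
  by rewrite -setXTT na// -f1; apply: eq_integral => z _; rewrite indicT mul1r.
have n2 : nm setT + b setT = 1.
  by rewrite -setXTT nb// -g1; apply: eq_integral => z _; rewrite indicT mul1r.
have ab : a setT = b setT.
  have nfin : nm setT \is a fin_num by exact: fin_num_measure.
  have := n1; rewrite -n2 addeC [RHS]addeC => /(congr1 (fun x => x - nm setT)).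
  by rewrite !addeK.
have [rho [rho1 rho2 rhoG]] := normalized_product ab.
pose s : {measure set (T1 * T2)%type -> \bar R} := measure_add nm rho.
have sE A : s A = nm A + rho A by exact: measure_addE.
have s1 A : measurable A -> s (A `*` setT) = \int[pi]_z (\1_A z.1 * f z.1)%:E.
  by move=> mA; rewrite sE rho1// na.
have s2 A : measurable A -> s (setT `*` A) = \int[pi]_z (\1_A z.2 * g z.2)%:E.
  by move=> mA; rewrite sE rho2// nb.
have sT : s setT = 1.
  rewrite -setXTT s1// -f1; apply: eq_integral => z _.
  by rewrite indicT mul1r.
have [S SE] := probability_of sT.
exists S; split; [by move=> A; rewrite SE; exact: s1|by move=> A; rewrite SE; exact: s2|].
move=> G h1 h2 mG mh1 mh2 G0 h10 h20 Gh.
have mGE : measurable_fun setT (EFin \o G) by exact/measurable_EFinP.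
have mh1E : measurable_fun setT (EFin \o h1) by exact/measurable_EFinP.
have mh2E : measurable_fun setT (EFin \o h2) by exact/measurable_EFinP.
have mfst : measurable_fun setT (fun z : T1 * T2 => h1 z.1) by exact: measurableT_comp.
have msnd : measurable_fun setT (fun z : T1 * T2 => h2 z.2) by exact: measurableT_comp.
rewrite SE ge0_integral_measure_add//; last by move=> z _; rewrite lee_fin.
have := @rhoG _ _ _ mGE mh1E mh2E (fun z => G0 z) (fun z => h10 z) (fun z => h20 z)
  (fun x y => Gh x y).
rewrite nmE// aE// bE//= => rhoG'.
have ge0F (k : T1 * T2 -> R) : (forall z, 0 <= k z)%R ->
    forall z, [set: T1 * T2] z -> 0 <= (k z)%:E by move=> k0 z _; rewrite lee_fin.
apply: (le_trans (leeD2l _ rhoG')).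
under eq_integral do rewrite -EFinM.
under [X in _ + (X + _)]eq_integral do rewrite -EFinM.
under [X in _ + (_ + X)]eq_integral do rewrite -EFinM.
rewrite -ge0_integralD//; last 4 first.
- by apply: ge0F => z; rewrite mulr_ge0.
- by apply/measurable_EFinP; exact: measurable_funM.
- by apply: ge0F => z; rewrite mulr_ge0.
- by apply/measurable_EFinP; exact: measurable_funM.
rewrite -ge0_integralD//; last 4 first.
- by apply: ge0F => z; rewrite mulr_ge0.
- by apply/measurable_EFinP; exact: measurable_funM.
- by move=> z _; rewrite adde_ge0// lee_fin mulr_ge0.
- by apply: emeasurable_funD; apply/measurable_EFinP; exact: measurable_funM.
apply: ge0_le_integral => //.
- by move=> z _; rewrite !adde_ge0// lee_fin mulr_ge0.
- apply: emeasurable_funD; first by apply/measurable_EFinP; exact: measurable_funM.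
  by apply: emeasurable_funD; apply/measurable_EFinP; exact: measurable_funM.
- apply/measurable_EFinP; apply: measurable_funD; first exact: measurable_funM.
  apply: measurable_funM; first exact: measurable_funD.
  by apply: measurableT_comp => //; exact: measurable_funB.
- move=> z _; rewrite -!EFinD lee_fin lerD2l mulrDl.
  have oF : (F z - o z <= `|f z.1 - g z.2|)%R.
    rewrite /o /F /H; have [_|_] := leP (f z.1) (g z.2); last exact: ler_norm.
    by rewrite subrr.
  have oH : (H z - o z <= `|f z.1 - g z.2|)%R.
    rewrite /o /F /H; have [_|_] := leP (f z.1) (g z.2); last by rewrite subrr.
    by rewrite distrC ler_norm.
  by apply: lerD; apply: ler_wpM2l.
Qed.

End overlap_coupling.

(** * Pointwise domination of the cost *)

(** Below [d], [u] and [v] stand for [d(x, y)], [d(x, xs)] and [d(y, xs)], and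
    [eps] for an upper bound on the [L^p] norm of [d]. *)

Section pointwise_estimates.
Context {R : realType}.
Variables (p q a eps d u v : R).
Hypotheses (p_gt0 : 0 < p) (p_lt_q : p < q).
Hypotheses (a_ge0 : 0 <= a) (a_le : p / q + a <= 1).
Hypotheses (eps_gt0 : 0 < eps) (d_ge0 : 0 <= d) (u_ge0 : 0 <= u) (v_ge0 : 0 <= v).
Hypothesis triangle : d <= u + v.

(** The sum of the bounds that [powR_mul_le] and [powR_le_1D] give, for
    [w = d / eps], on [w ^ (p * a) * u ^ p], [w ^ (p * a) * v ^ p] and
    [w ^ (p * a)]; its integral is bounded independently of [eps]. *)
Definition envelope : R := 3 + 3 * (d `^ p / eps `^ p) + u `^ q + v `^ q.

Let q_gt0 : 0 < q. Proof. exact: lt_trans p_gt0 p_lt_q. Qed.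
Let pq_ge0 : 0 <= p / q. Proof. by rewrite divr_ge0 ?ltW. Qed.
Let pq_le1 : p / q <= 1. Proof. by rewrite ler_pdivrMr// mul1r ltW. Qed.
Let powRpq x : x `^ p = (x `^ q) `^ (p / q).
Proof. by rewrite -powRrM mulrCA mulfV ?mulr1// gt_eqF. Qed.
Let ratio_ge0 : 0 <= d `^ p / eps `^ p.
Proof. by rewrite divr_ge0 ?powR_ge0. Qed.

Lemma envelope_ge0 : 0 <= envelope.
Proof.
have := powR_ge0 u q; have := powR_ge0 v q; have := ratio_ge0.
by rewrite /envelope; lra.
Qed.

Lemma powR_moments_le_envelope : u `^ p + v `^ p <= envelope.
Proof.
have hu := powR_le_1D (powR_ge0 u q) pq_ge0 pq_le1.
have hv := powR_le_1D (powR_ge0 v q) pq_ge0 pq_le1.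
rewrite !powRpq /envelope; have := ratio_ge0; lra.
Qed.

(** The key estimate: after factoring out [eps ^ (p * a)], what remains is
    [w ^ (p * a) * u ^ p] with [w = d / eps], where [w ^ (p * a)] is the power
    [a] of [w ^ p] and [u ^ p] is the power [p / q] of [u ^ q]. *)
Lemma powR_dist_moments_le :
  d `^ (p * a) * (1 + u `^ p + v `^ p) <= eps `^ (p * a) * envelope.
Proof.
have -> : d `^ (p * a) = eps `^ (p * a) * (d `^ p / eps `^ p) `^ a.
  rewrite !powRrM -powRM ?powR_ge0//; congr (_ `^ _).
  by rewrite mulrCA mulfV ?mulr1// gt_eqF// powR_gt0.
rewrite -mulrA; apply: ler_wpM2l; first exact: powR_ge0.
have hu := powR_mul_le (powR_ge0 u q) ratio_ge0 pq_ge0 a_ge0 a_le.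
have hv := powR_mul_le (powR_ge0 v q) ratio_ge0 pq_ge0 a_ge0 a_le.
have a1 : a <= 1 by apply: le_trans a_le; rewrite lerDr.
have h1 := powR_le_1D ratio_ge0 a_ge0 a1.
move: hu hv h1; rewrite -!powRpq /envelope.
set t := (d `^ p / eps `^ p) `^ a.
by rewrite mulrDr mulrDr mulr1 !(mulrC t); lra.
Qed.

(** Although [d ^ p] itself has integral at most [eps ^ p], this may exceed
    [eps ^ (p * a)] when [eps] is large.  Writing
    [d ^ p = d ^ (p * a) * d ^ (p * (1 - a))] and bounding the last factor by
    the moments avoids a separate treatment of large [eps]. *)
Lemma powR_dist_le : d `^ p <= 2 `^ p * (eps `^ (p * a) * envelope).
Proof.
apply: (@le_trans _ _ (2 `^ p * (d `^ (p * a) * (1 + u `^ p + v `^ p)))); last first.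
  by apply: ler_wpM2l; [exact: powR_ge0|exact: powR_dist_moments_le].
have two1 : 1 <= 2 `^ p :> R.
  by rewrite -[leLHS](powRr0 2); apply: ler_powR => //; [lra|exact: ltW].
have a1 : a <= 1 by apply: le_trans a_le; rewrite lerDr.
have -> : d `^ p = d `^ (p * a) * d `^ (p * (1 - a)).
  rewrite -powRD; first by rewrite mulrBr mulr1 addrC subrK.
  by apply/implyP; rewrite mulrBr mulr1 addrC subrK gt_eqF.
rewrite mulrCA; apply: ler_wpM2l; first exact: powR_ge0.
rewrite powRrM.
have h : (d `^ p) `^ (1 - a) <= 1 + d `^ p.
  apply: powR_le_1D; first exact: powR_ge0.
    by rewrite subr_ge0.
  by rewrite lerBlDr lerDl.
have dp : d `^ p <= 2 `^ p * (u `^ p + v `^ p).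
  apply: le_trans (powRD_le u_ge0 v_ge0 (ltW p_gt0)).
  by apply: ge0_ler_powR; rewrite ?nnegrE ?addr_ge0// ltW.
rewrite -addrA mulrDr mulr1; lra.
Qed.

(** Here [lx / Zx] and [ly / Zy] are the posterior densities at [x] and [y].
    Their difference splits into the variation of the likelihood and that of
    the normalizing constants; the former is multiplied by the moments and
    needs [powR_dist_moments_le], the latter is already of order
    [eps ^ (p * a)]. *)
Lemma overlap_cost_le (z K N lx ly Zx Zy : R) :
  0 < z -> z <= Zx -> z <= Zy -> 0 <= K -> 0 <= N ->
  0 <= lx <= 1 -> 0 <= ly <= 1 ->
  `|lx - ly| <= K * d `^ (p * a) -> `|Zx - Zy| <= K * (eps `^ (p * a) * N) ->
  d `^ p * Num.min (lx / Zx) (ly / Zy) +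
    (2 `^ p * u `^ p + 2 `^ p * v `^ p) * `|lx / Zx - ly / Zy| <=
  2 `^ p * (z^-1 + z^-1 * K + z^-1 * z^-1 * K * N) * (eps `^ (p * a) * envelope).
Proof.
move=> z0 zZx zZy K0 N0 /andP[lx0 lx1] /andP[ly0 ly1] lxy Zxy.
have Zx0 : 0 < Zx by exact: lt_le_trans zZx.
have Zy0 : 0 < Zy by exact: lt_le_trans zZy.
have iz0 : 0 <= z^-1 by rewrite invr_ge0 ltW.
have iZx : Zx^-1 <= z^-1 by rewrite lef_pV2.
have iZy : Zy^-1 <= z^-1 by rewrite lef_pV2.
have iZx0 : 0 <= Zx^-1 by rewrite invr_ge0 ltW.
have iZy0 : 0 <= Zy^-1 by rewrite invr_ge0 ltW.
have two0 : 0 <= 2 `^ p :> R by exact: powR_ge0.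
have e0 : 0 <= eps `^ (p * a) by exact: powR_ge0.
have up0 : 0 <= u `^ p by exact: powR_ge0.
have vp0 : 0 <= v `^ p by exact: powR_ge0.
have overlap : d `^ p * Num.min (lx / Zx) (ly / Zy) <=
    2 `^ p * (z^-1 * (eps `^ (p * a) * envelope)).
  rewrite mulrCA mulrC; apply: ler_pM => //.
  - by rewrite le_min !mulr_ge0.
  - exact: powR_ge0.
  - rewrite ge_min; apply/orP; left; rewrite -[leRHS]mul1r.
    by apply: ler_pM.
  - exact: powR_dist_le.
have residual : `|lx / Zx - ly / Zy| <=
    z^-1 * K * d `^ (p * a) + z^-1 * z^-1 * K * N * eps `^ (p * a).
  have -> : lx / Zx - ly / Zy =
      Zx^-1 * (lx - ly) + ly * (Zx^-1 * Zy^-1) * (Zy - Zx).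
    by field; rewrite !gt_eqF.
  apply: (le_trans (ler_normD _ _)); apply: lerD.
    rewrite normrM ger0_norm// -mulrA; exact: ler_pM.
  rewrite normrM distrC ger0_norm ?mulr_ge0//.
  have -> : z^-1 * z^-1 * K * N * eps `^ (p * a) =
      1 * (z^-1 * z^-1) * (K * (eps `^ (p * a) * N)) by ring.
  apply: ler_pM => //; first by rewrite !mulr_ge0.
  by apply: ler_pM => //; [rewrite mulr_ge0|exact: ler_pM].
have moment_dist : d `^ (p * a) * (u `^ p + v `^ p) <= eps `^ (p * a) * envelope.
  apply: le_trans powR_dist_moments_le; apply: ler_wpM2l; first exact: powR_ge0.
  lra.
have moment_shift : eps `^ (p * a) * (u `^ p + v `^ p) <= eps `^ (p * a) * envelope.
  by apply: ler_wpM2l => //; exact: powR_moments_le_envelope.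
rewrite -mulrDr.
have -> : 2 `^ p * (z^-1 + z^-1 * K + z^-1 * z^-1 * K * N) * (eps `^ (p * a) * envelope) =
    2 `^ p * (z^-1 * (eps `^ (p * a) * envelope)) +
    2 `^ p * (z^-1 * K * (eps `^ (p * a) * envelope) +
      z^-1 * z^-1 * K * N * (eps `^ (p * a) * envelope)) by ring.
apply: lerD => //; rewrite -mulrA; apply: ler_wpM2l => //.
apply: (@le_trans _ _ (z^-1 * K * (d `^ (p * a) * (u `^ p + v `^ p)) +
    z^-1 * z^-1 * K * N * (eps `^ (p * a) * (u `^ p + v `^ p)))).
  have -> : z^-1 * K * (d `^ (p * a) * (u `^ p + v `^ p)) +
    z^-1 * z^-1 * K * N * (eps `^ (p * a) * (u `^ p + v `^ p)) =
    (u `^ p + v `^ p) * (z^-1 * K * d `^ (p * a) + z^-1 * z^-1 * K * N * eps `^ (p * a)).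
    by ring.
  by apply: ler_wpM2l => //; rewrite addr_ge0.
by apply: lerD; apply: ler_wpM2l => //; rewrite !mulr_ge0.
Qed.

End pointwise_estimates.

(** * Marginals of a coupling and Hoelder bounds *)

Section couplings.
Context {R : realType} {X : completeMetricType R}.
Local Open Scope ereal_scope.

Lemma coupling_integral_fst (mu nu : {measure set (borel X) -> \bar R})
    (pi : probability (borel X * borel X)%type R) (h : borel X -> \bar R) :
  coupling mu nu pi -> measurable_fun setT h -> (forall x, 0 <= h x) ->
  \int[mu]_x h x = \int[pi]_z h z.1.
Proof.
move=> cpi mh h0.
rewrite -[RHS]/(\int[pi]_(z in fst @^-1` setT) (h \o fst) z).
rewrite -(ge0_integral_pushforward measurable_fst)//.
apply: eq_measure_integral => A mA _.
rewrite -(cpi A mA).1 /pushforward; congr (pi _).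
by apply/seteqP; split => -[x y] //= [].
Qed.

Lemma coupling_integral_snd (mu nu : {measure set (borel X) -> \bar R})
    (pi : probability (borel X * borel X)%type R) (h : borel X -> \bar R) :
  coupling mu nu pi -> measurable_fun setT h -> (forall x, 0 <= h x) ->
  \int[nu]_x h x = \int[pi]_z h z.2.
Proof.
move=> cpi mh h0.
rewrite -[RHS]/(\int[pi]_(z in snd @^-1` setT) (h \o snd) z).
rewrite -(ge0_integral_pushforward measurable_snd)//.
apply: eq_measure_integral => A mA _.
rewrite -(cpi A mA).2 /pushforward; congr (pi _).
by apply/seteqP; split => -[x y] //= [].
Qed.

Lemma holder_seminorm_bound (b K : R) (L : X -> R) :
  holder_seminorm b L = K%:E ->
  (0 <= K)%R /\ forall x y, (`|L x - L y| <= K * mdist x y `^ b)%R.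
Proof.
move=> LK; have K0 : (0 <= K)%R.
  by rewrite -lee_fin -LK; apply: ereal_sup_ubound; left.
split=> // x y; have [->|/eqP xy] := eqVneq x y.
  by rewrite subrr normr0 mulr_ge0// powR_ge0.
rewrite -ler_pdivrMr; last by rewrite powR_gt0// mdist_gt0; exact/eqP.
by rewrite -lee_fin -LK; apply: ereal_sup_ubound; right; exists (x, y).
Qed.

End couplings.

(** A bounded Hoelder function is Hoelder for every smaller exponent: up to
    distance [1] lowering the exponent enlarges the power, and beyond it the
    bound [1] suffices. *)
Lemma holder_lower_exponent {R : realType} (K b s d l : R) :
  0 <= K -> 0 < b -> 0 <= s -> s <= b -> 0 <= d -> l <= K * d `^ b -> l <= 1 ->
  l <= (1 + K) * d `^ s.
Proof.
move=> K0 b0 s0 sb d0 lK l1.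
have := powR_ge0 d s => ds0.
have [d1|/ltW d1] := leP d 1.
  have : d `^ b <= d `^ s.
    move: d0; rewrite le_eqVlt => /predU1P[<-|d0]; first by rewrite powR0 ?gt_eqF// powR_ge0.
    by apply: ger_powR => //; rewrite d0.
  by move=> dbs; apply: (le_trans lK); nra.
have : 1 <= d `^ s by rewrite -[leLHS](powRr0 d); exact: ler_powR.
by move=> ds1; apply: (le_trans l1); nra.
Qed.

(** * Coupling the posteriors *)

Section posterior_coupling.
Context {R : realType} {X : completeMetricType R}.
Variables (xs : X) (L : X -> R) (b K p q B z a : R).
Hypotheses (Xsep : separable X) (b_gt0 : 0 < b) (K_ge0 : 0 <= K).
Hypotheses (L01 : forall x, 0 <= L x <= 1)
  (LH : forall x y, `|L x - L y| <= K * mdist x y `^ b).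
Hypotheses (p_gt0 : 0 < p) (p_lt_q : p < q) (B_ge0 : 0 <= B) (z_gt0 : 0 < z).
Hypotheses (a_gt0 : 0 < a) (pa_le : p * a <= b) (a_le : p / q + a <= 1).
Variables mu nu : probability (borel X) R.
Hypotheses (Cmu : stability_class xs q B z L mu) (Cnu : stability_class xs q B z L nu).

Let mL : measurable_fun [set: borel X] (L : borel X -> R).
Proof. exact: holder_measurable LH. Qed.

Let L0 x : 0 <= L x. Proof. by have /andP[] := L01 x. Qed.

Let mdist_powR_measurable (r : R) :
  measurable_fun [set: borel X] (fun x : borel X => mdist (x : X) xs `^ r).
Proof. by apply: (measurableT_comp (measurable_powR r)); exact: mdist_measurable. Qed.

Lemma evidence_bounds (P : probability (borel X) R) :
  stability_class xs q B z L P ->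
  evidence L P = (fine (evidence L P))%:E /\ z <= fine (evidence L P).
Proof.
move=> [_ _ zP].
have P1 : (evidence L P <= 1)%E.
  rewrite /evidence -[leRHS](@probability_setT _ _ _ P) -[leRHS]mul1e -integral_cst//.
  apply: ge0_le_integral => //.
  - by move=> x _; rewrite lee_fin.
  - exact/measurable_EFinP.
  - by move=> x _; rewrite lee_fin; have /andP[] := L01 x.
have Pfin : evidence L P \is a fin_num.
  rewrite ge0_fin_numE ?(le_lt_trans P1) ?ltry//.
  by apply: le_trans zP; rewrite lee_fin ltW.
by split; [rewrite fineK|rewrite -lee_fin fineK].
Qed.

Definition pair_envelope (eps : R) (w : borel X * borel X) : R :=
  envelope p q eps (mdist (w.1 : X) (w.2 : X)) (mdist (w.1 : X) xs) (mdist (w.2 : X) xs).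

Variables (pi : probability (borel X * borel X)%type R) (eps : R).
Hypotheses (cpi : coupling mu nu pi) (eps_gt0 : 0 < eps).
Hypothesis cost_pi :
  (\int[pi]_w ((mdist (w.1 : X) (w.2 : X)) `^ p)%:E <= (eps `^ p)%:E)%E.

Let mD : measurable_fun setT
  (fun w : borel X * borel X => mdist (w.1 : X) (w.2 : X) `^ p).
Proof.
apply: (measurableT_comp (measurable_powR p)).
exact: separable_mdist_measurable.
Qed.

Let mpair_envelope : measurable_fun setT (pair_envelope eps).
Proof.
apply: measurable_funD; last first.
  exact: (measurableT_comp (mdist_powR_measurable q) measurable_snd).
apply: measurable_funD; last first.
  exact: (measurableT_comp (mdist_powR_measurable q) measurable_fst).
apply: measurable_funD => //; apply: measurable_funM => //.
exact: measurable_funM.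
Qed.

Let pair_envelope_ge0 w : 0 <= pair_envelope eps w.
Proof. by apply: envelope_ge0. Qed.

(** This is where the assumptions on [mu], [nu] and [pi] enter: each of the two
    moments contributes [B], and the cost of [pi] is at most [eps ^ p], so that
    its multiple contributes [3]. *)
Lemma integral_envelope : (\int[pi]_w (pair_envelope eps w)%:E <= (6 + 2 * B)%:E)%E.
Proof.
have [_ mu_q _] := Cmu; have [_ nu_q _] := Cnu.
have ip0 : 0 <= 3 * (eps `^ p)^-1 by rewrite mulr_ge0// invr_ge0 powR_ge0.
have scaled_ge0 w : 0 <= 3 * (eps `^ p)^-1 * mdist (w.1 : X) (w.2 : X) `^ p.
  by rewrite mulr_ge0 ?powR_ge0.
have mu_pi : moment xs q mu = (\int[pi]_w (mdist (w.1 : X) xs `^ q)%:E)%E.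
  rewrite /moment (coupling_integral_fst cpi)//.
  - exact/measurable_EFinP.
  - by move=> x; rewrite lee_fin powR_ge0.
have nu_pi : moment xs q nu = (\int[pi]_w (mdist (w.2 : X) xs `^ q)%:E)%E.
  rewrite /moment (coupling_integral_snd cpi)//.
  - exact/measurable_EFinP.
  - by move=> x; rewrite lee_fin powR_ge0.
have mu1 : measurable_fun setT (fun w : borel X * borel X => mdist (w.1 : X) xs `^ q).
  exact: (measurableT_comp (mdist_powR_measurable q) measurable_fst).
have mu2 : measurable_fun setT (fun w : borel X * borel X => mdist (w.2 : X) xs `^ q).
  exact: (measurableT_comp (mdist_powR_measurable q) measurable_snd).
have mcD : measurable_fun setT (fun w : borel X * borel X =>
    3 * (eps `^ p)^-1 * mdist (w.1 : X) (w.2 : X) `^ p) by exact: measurable_funM.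
have pair_envelopeE w : (pair_envelope eps w)%:E =
   (3%:E + ((3 * (eps `^ p)^-1) * mdist (w.1 : X) (w.2 : X) `^ p)%:E +
    (mdist (w.1 : X) xs `^ q)%:E + (mdist (w.2 : X) xs `^ q)%:E)%E.
  by rewrite -!EFinD /pair_envelope /envelope; congr (_%:E); ring.
under eq_integral do rewrite pair_envelopeE.
rewrite ge0_integralD//; first last.
- exact/measurable_EFinP.
- by move=> w _; rewrite lee_fin powR_ge0.
- by do 2 (apply: emeasurable_funD; last exact/measurable_EFinP); exact: measurable_cst.
- by move=> w _; do ?apply: adde_ge0; rewrite lee_fin// ?powR_ge0.
rewrite ge0_integralD//; first last.
- exact/measurable_EFinP.
- by move=> w _; rewrite lee_fin powR_ge0.
- by apply: emeasurable_funD; [exact: measurable_cst|exact/measurable_EFinP].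
- by move=> w _; do ?apply: adde_ge0; rewrite lee_fin// ?powR_ge0.
rewrite ge0_integralD//; first last.
- exact/measurable_EFinP.
- by move=> w _; rewrite lee_fin mulr_ge0 ?powR_ge0.
rewrite integral_cst//= [X in (_ * X)%E]probability_setT mule1 -mu_pi -nu_pi.
under eq_integral do rewrite EFinM.
rewrite ge0_integralZl//; first last.
- by move=> w _; rewrite lee_fin powR_ge0.
- exact/measurable_EFinP.
apply: (@le_trans _ _ (3%:E + (3 * (eps `^ p)^-1)%:E * (eps `^ p)%:E + B%:E + B%:E)%E).
  do 2 (apply: leeD => //); apply: leeD2l; exact: lee_wpmul2l.
rewrite -EFinM -!EFinD lee_fin -mulrA mulVf ?gt_eqF ?powR_gt0//; lra.
Qed.

Let N := 6 + 2 * B.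
Let A := 2 `^ p * (z^-1 + z^-1 * (1 + K) + z^-1 * z^-1 * (1 + K) * N).
Let Zm := fine (evidence L mu).
Let Zn := fine (evidence L nu).

Let N_ge0 : 0 <= N. Proof. by rewrite addr_ge0// mulr_ge0. Qed.

Let likelihood_diff (w : borel X * borel X) : `|L w.1 - L w.2| <=
  (1 + K) * mdist (w.1 : X) (w.2 : X) `^ (p * a).
Proof.
apply: holder_lower_exponent (LH w.1 w.2) _ => //.
- by rewrite mulr_ge0 ?ltW.
- exact: mdist_ge0.
- have /andP[? ?] := L01 w.1; have /andP[? ?] := L01 w.2.
  by rewrite ler_norml; lra.
Qed.

Let triangle (w : borel X * borel X) :
  mdist (w.1 : X) (w.2 : X) <= mdist (w.1 : X) xs + mdist (w.2 : X) xs.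
Proof. by rewrite (metric_sym (w.2 : X)); exact: metric_triangle. Qed.

Let dist_le_envelope (w : borel X * borel X) :
  mdist (w.1 : X) (w.2 : X) `^ (p * a) <= eps `^ (p * a) * pair_envelope eps w.
Proof.
apply: le_trans (powR_dist_moments_le _ _ _ _ _ _ _ _) => //; try exact: mdist_ge0.
  rewrite -[leLHS]mulr1; apply: ler_wpM2l; first exact: powR_ge0.
  by rewrite -addrA lerDl addr_ge0// powR_ge0.
exact: ltW.
Qed.

Let likelihood_diff_envelope (w : borel X * borel X) : `|L w.1 - L w.2| <=
  (1 + K) * eps `^ (p * a) * pair_envelope eps w.
Proof.
apply: (le_trans (likelihood_diff w)); rewrite -mulrA ler_wpM2l//.
by rewrite addr_ge0.
Qed.

Let mLE : measurable_fun [set: borel X] (fun x : borel X => (L x)%:E).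
Proof. exact/measurable_EFinP. Qed.

Let mu_evidence : (\int[pi]_w (L w.1)%:E = Zm%:E)%E.
Proof.
rewrite -(evidence_bounds Cmu).1 /evidence (coupling_integral_fst cpi)//.
Qed.

Let nu_evidence : (\int[pi]_w (L w.2)%:E = Zn%:E)%E.
Proof.
rewrite -(evidence_bounds Cnu).1 /evidence (coupling_integral_snd cpi)//.
Qed.

Let mL1 : measurable_fun setT (fun w : borel X * borel X => (L w.1)%:E).
Proof. exact: (measurableT_comp mLE measurable_fst). Qed.

Let mL2 : measurable_fun setT (fun w : borel X * borel X => (L w.2)%:E).
Proof. exact: (measurableT_comp mLE measurable_snd). Qed.

Let c_ge0 : 0 <= (1 + K) * eps `^ (p * a).
Proof. by rewrite mulr_ge0 ?powR_ge0// addr_ge0. Qed.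

(* Comparing evidences by one-sided inequalities avoids integrating a
   difference, for which integrability would be needed. *)
Let integral_le_shift (k l : borel X * borel X -> R) :
  measurable_fun setT (EFin \o k) -> measurable_fun setT (EFin \o l) ->
  (forall w, 0 <= k w) -> (forall w, 0 <= l w) ->
  (forall w, k w <= l w + (1 + K) * eps `^ (p * a) * pair_envelope eps w) ->
  (\int[pi]_w (k w)%:E <= \int[pi]_w (l w)%:E +
    ((1 + K) * (eps `^ (p * a) * N))%:E)%E.
Proof.
move=> mk ml k0 l0 kl.
have mcpair_envelope : measurable_fun setT
    (fun w => ((1 + K) * eps `^ (p * a) * pair_envelope eps w)%:E).
  by apply/measurable_EFinP; exact: measurable_funM.
apply: (@le_trans _ _ (\int[pi]_w ((l w)%:E +
    ((1 + K) * eps `^ (p * a) * pair_envelope eps w)%:E))%E).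
  apply: ge0_le_integral => //.
  - by move=> w _; rewrite lee_fin.
  - exact: emeasurable_funD.
  - by move=> w _; rewrite -EFinD lee_fin.
rewrite ge0_integralD//.
- apply: leeD2l; under eq_integral do rewrite EFinM.
  rewrite ge0_integralZl//.
  + rewrite mulrA [leRHS]EFinM lee_wpmul2l//; exact: integral_envelope.
  + exact/measurable_EFinP.
  + by move=> w _; rewrite lee_fin.
- by move=> w _; rewrite lee_fin.
- by move=> w _; rewrite lee_fin mulr_ge0.
Qed.

Lemma evidence_dist_le : `|Zm - Zn| <= (1 + K) * (eps `^ (p * a) * N).
Proof.
have mn : Zm <= Zn + (1 + K) * (eps `^ (p * a) * N).
  rewrite -lee_fin EFinD -mu_evidence -nu_evidence.
  apply: integral_le_shift => // w.
  have := likelihood_diff_envelope w; rewrite ler_norml; lra.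
have nm : Zn <= Zm + (1 + K) * (eps `^ (p * a) * N).
  rewrite -lee_fin EFinD -mu_evidence -nu_evidence.
  apply: integral_le_shift => // w.
  have := likelihood_diff_envelope w; rewrite ler_norml; lra.
rewrite ler_norml; lra.
Qed.

Let Zm_gt0 : 0 < Zm. Proof. exact: lt_le_trans (evidence_bounds Cmu).2. Qed.
Let Zn_gt0 : 0 < Zn. Proof. exact: lt_le_trans (evidence_bounds Cnu).2. Qed.

(** The stability estimate at the level of a single coupling; the constant is
    that of [overlap_cost_le] times the bound on the integral of the
    envelope. *)
Lemma posterior_coupling : exists2 rho, coupling (posterior L mu) (posterior L nu) rho &
  (\int[rho]_w ((mdist (w.1 : X) (w.2 : X)) `^ p)%:E <= (A * N * eps `^ (p * a))%:E)%E.
Proof.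
pose f (x : borel X) := L x / Zm; pose g (x : borel X) := L x / Zn.
have mf : measurable_fun setT f by exact: measurable_funM.
have mg : measurable_fun setT g by exact: measurable_funM.
have f0 x : 0 <= f x by rewrite divr_ge0// ltW.
have g0 x : 0 <= g x by rewrite divr_ge0// ltW.
have posteriorE (P : probability (borel X) R) S : measurable S ->
    stability_class xs q B z L P ->
    posterior L P S = (\int[P]_x (\1_S x * (L x / fine (evidence L P)))%:E)%E.
  move=> mS PC; have PZ := lt_le_trans z_gt0 (evidence_bounds PC).2.
  rewrite /posterior [X in (_ * X)%E]integral_mkcond -ge0_integralZl//; first last.
  - by rewrite lee_fin invr_ge0 ltW.
  - by move=> x _; apply: erestrict_ge0 => y _; rewrite lee_fin.
  - by apply/(measurable_restrictT _ _).1 => //; exact: measurable_funTS.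
  apply: eq_integral => x _.
  by rewrite (epatch_indic (fun x => (L x)%:E)) -!EFinM mulrC (mulrC (L x)) mulrA.
have f1 : (\int[pi]_w (f w.1)%:E = 1)%E.
  under eq_integral do rewrite EFinM.
  rewrite ge0_integralZr//; last 2 first.
  - by move=> w _; rewrite lee_fin.
  - by rewrite lee_fin invr_ge0 ltW.
  by rewrite mu_evidence -EFinM mulfV// gt_eqF.
have g1 : (\int[pi]_w (g w.2)%:E = 1)%E.
  under eq_integral do rewrite EFinM.
  rewrite ge0_integralZr//; last 2 first.
  - by move=> w _; rewrite lee_fin.
  - by rewrite lee_fin invr_ge0 ltW.
  by rewrite nu_evidence -EFinM mulfV// gt_eqF.
have [rho [rho1 rho2 rhoG]] := overlap_coupling mf mg f0 g0 f1 g1.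
exists rho.
  move=> S mS; rewrite rho1// rho2// !posteriorE//; split; apply/esym.
  - apply: (coupling_integral_fst cpi).
      by apply/measurable_EFinP; exact: measurable_funM.
    by move=> x; rewrite lee_fin mulr_ge0//; exact: f0.
  - apply: (coupling_integral_snd cpi).
      by apply/measurable_EFinP; exact: measurable_funM.
    by move=> x; rewrite lee_fin mulr_ge0//; exact: g0.
have two0 : 0 <= 2 `^ p :> R by exact: powR_ge0.
apply: (le_trans (@rhoG (fun w => mdist (w.1 : X) (w.2 : X) `^ p)
  (fun x => 2 `^ p * mdist (x : X) xs `^ p) (fun x => 2 `^ p * mdist (x : X) xs `^ p)
  _ _ _ _ _ _ _)) => //.
- exact: measurable_funM.
- exact: measurable_funM.
- by move=> w; exact: powR_ge0.
- by move=> x; rewrite mulr_ge0// powR_ge0.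
- by move=> x; rewrite mulr_ge0// powR_ge0.
- move=> x y /=; rewrite -mulrDr; apply: le_trans (powRD_le _ _ _) => //; try exact: mdist_ge0.
  + apply: ge0_ler_powR; last exact: (triangle (x, y)).
    * exact: ltW.
    * by rewrite nnegrE mdist_ge0.
    * by rewrite nnegrE addr_ge0// mdist_ge0.
  + exact: ltW.
have A0 : 0 <= A.
  by rewrite /A !(mulr_ge0, addr_ge0)// ?invr_ge0 ?ltW.
apply: (@le_trans _ _ (\int[pi]_w ((A * eps `^ (p * a))%:E * (pair_envelope eps w)%:E))%E).
  apply: ge0_le_integral => //.
  - move=> w _; rewrite lee_fin addr_ge0// mulr_ge0// ?powR_ge0// ?le_min ?f0 ?g0//.
    by rewrite addr_ge0// mulr_ge0// powR_ge0.
  - have mf1 : measurable_fun setT (fun w : borel X * borel X => f w.1).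
      exact: (measurableT_comp mf measurable_fst).
    have mg2 : measurable_fun setT (fun w : borel X * borel X => g w.2).
      exact: (measurableT_comp mg measurable_snd).
    have mu1 := measurableT_comp (mdist_powR_measurable p)
      (@measurable_fst _ _ (borel X) (borel X)).
    have mu2 := measurableT_comp (mdist_powR_measurable p)
      (@measurable_snd _ _ (borel X) (borel X)).
    apply/measurable_EFinP; apply: measurable_funD.
      by apply: measurable_funM => //; exact: measurable_minr.
    apply: measurable_funM; first by apply: measurable_funD; exact: measurable_funM.
    by apply: measurableT_comp => //; exact: measurable_funB.
  - by apply: emeasurable_funM; exact/measurable_EFinP.
  - move=> w _; rewrite -EFinM lee_fin -mulrA.
    apply: overlap_cost_le; rewrite ?mdist_ge0//; try exact: ltW.
    + exact: (evidence_bounds Cmu).2.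
    + exact: (evidence_bounds Cnu).2.
    + by rewrite addr_ge0.
    + exact: evidence_dist_le.
rewrite ge0_integralZl//; last 3 first.
- exact/measurable_EFinP.
- by move=> w _; rewrite lee_fin.
- by rewrite lee_fin mulr_ge0// powR_ge0.
rewrite (mulrAC A) [leRHS]EFinM lee_wpmul2l//; last exact: integral_envelope.
by rewrite lee_fin mulr_ge0// powR_ge0.
Qed.

End posterior_coupling.

(** * Stability of the posterior *)

Theorem theorem4p1 (R : realType) (beta K p q B zeta : R)
    (beta_gt0 : 0 < beta) (beta_le1 : beta <= 1)
    (p_ge1 : 1 <= p) (p_lt_q : p < q)
    (B_ge0 : 0 <= B) (zeta_gt0 : 0 < zeta) (zeta_le1 : zeta <= 1) :
  exists2 C : R, 0 < C &
    forall (X : completeMetricType R) (xs : X) (L : X -> R),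
      separable X ->
      (forall x, 0 <= L x <= 1) ->
      holder_seminorm beta L = K%:E ->
      forall mu nu : probability (borel X) R,
        stability_class xs q B zeta L mu ->
        stability_class xs q B zeta L nu ->
        (wasserstein p (posterior L mu) (posterior L nu)
          <= C%:E * (wasserstein p mu nu) `^ (Num.min (beta / p) (1 - p / q))%R)%E.
Proof.
have p_gt0 : 0 < p by exact: lt_le_trans p_ge1.
have q_gt0 : 0 < q by exact: lt_trans p_lt_q.
set a := Num.min (beta / p) (1 - p / q).
have a_gt0 : 0 < a.
  by rewrite lt_min divr_gt0//= subr_gt0 ltr_pdivrMr// mul1r.
have pa_le : p * a <= beta.
  by rewrite mulrC -ler_pdivlMr// ge_min lexx.
have a_le : p / q + a <= 1.
  by rewrite addrC -lerBrDr ge_min lexx orbT.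
(* the constant is chosen before the likelihood, hence before K is known to be
   a Hoelder seminorm *)
have [K_lt0|K_ge0] := ltP K 0.
  exists 1 => // X xs L _ _ /holder_seminorm_bound[K0 _].
  by move: K_lt0; rewrite ltNge K0.
pose N := 6 + 2 * B.
pose A := 2 `^ p * (zeta^-1 + zeta^-1 * (1 + K) + zeta^-1 * zeta^-1 * (1 + K) * N).
have N_gt0 : 0 < N by rewrite ltr_wpDr// mulr_ge0.
have A_gt0 : 0 < A.
  have iz : 0 < zeta^-1 by rewrite invr_gt0.
  have K1 : 0 <= 1 + K by rewrite addr_ge0.
  have N0 : 0 <= N by exact: ltW.
  rewrite mulr_gt0// ?powR_gt0// -addrA ltr_wpDr//.
  by rewrite addr_ge0// !mulr_ge0// ltW.
have AN_gt0 : 0 < A * N by exact: mulr_gt0.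
exists ((A * N) `^ p^-1); first exact: powR_gt0.
move=> X xs L Xsep L01 LK mu nu Cmu Cnu.
have [_ LH] := holder_seminorm_bound LK.
have ip_ge0 : 0 <= p^-1 by rewrite invr_ge0 ltW.
have inf_ge0 (m n : set (borel X) -> \bar R) :
    (0 <= ereal_inf [set \int[pi]_z ((mdist (z.1 : X) (z.2 : X)) `^ p)%:E
             | pi in coupling m n])%E.
  apply: le_ereal_inf_tmp => _ [pi _ <-]; apply: integral_ge0 => z _.
  by rewrite lee_fin powR_ge0.
have stab (e : R) : (wasserstein p mu nu < e%:E)%E ->
    (wasserstein p (posterior L mu) (posterior L nu) <= ((A * N) `^ p^-1 * e `^ a)%:E)%E.
  move=> We.
  have e_gt0 : 0 < e by rewrite -lte_fin; apply: le_lt_trans We; exact: poweR_ge0.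
  have : (ereal_inf [set \int[pi]_z ((mdist (z.1 : X) (z.2 : X)) `^ p)%:E
             | pi in coupling mu nu] < (e `^ p)%:E)%E.
    rewrite ltNge; apply/negP => le_inf; move: We; apply/negP; rewrite -leNgt.
    have -> : e%:E = ((e `^ p)%:E `^ p^-1)%E.
      by rewrite poweR_EFin -powRrM mulfV ?gt_eqF// powRr1// ltW.
    by apply: gt0_ler_poweR => //; rewrite in_itv/= leey ?inf_ge0 ?lee_fin ?powR_ge0.
  move=> /ereal_inf_lt[_ [pi cpi <-]] /ltW cost_pi.
  have [rho crho cost_rho] := posterior_coupling Xsep beta_gt0 K_ge0 L01 LH p_gt0
    p_lt_q B_ge0 zeta_gt0 a_gt0 pa_le a_le Cmu Cnu cpi e_gt0 cost_pi.
  have -> : (A * N) `^ p^-1 * e `^ a = (A * N * e `^ (p * a)) `^ p^-1.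
    rewrite [RHS]powRM ?powR_ge0//; last exact: ltW.
    by rewrite -powRrM (mulrAC p) mulfV ?mul1r// gt_eqF.
  rewrite -poweR_EFin; apply: gt0_ler_poweR => //.
  - by rewrite in_itv/= leey inf_ge0.
  - by rewrite in_itv/= leey lee_fin mulr_ge0 ?powR_ge0// ltW.
  - by apply: le_trans cost_rho; apply: ereal_inf_lbound; exists rho.
have W_ge0 : (0 <= wasserstein p mu nu)%E by exact: poweR_ge0.
have W'_ge0 : (0 <= wasserstein p (posterior L mu) (posterior L nu))%E.
  exact: poweR_ge0.
have [W_oo|W_fin] := eqVneq (wasserstein p mu nu) +oo%E.
  by rewrite W_oo poweRyr ?gt_eqF// gt0_muley ?leey// lte_fin powR_gt0.
have {}W_fin : wasserstein p mu nu \is a fin_num.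
  by rewrite ge0_fin_numE// ltey.
have WE := fineK W_fin; rewrite -WE in stab *.
have W'_fin : wasserstein p (posterior L mu) (posterior L nu) \is a fin_num.
  rewrite ge0_fin_numE//; apply: le_lt_trans (stab (fine (wasserstein p mu nu) + 1) _) _.
    by rewrite lte_fin ltrDl.
  exact: ltry.
rewrite -(fineK W'_fin) poweR_EFin -EFinM lee_fin.
apply: le_powR_of_gt => //.
- exact: powR_gt0.
- exact: fine_ge0.
- exact: fine_ge0.
- by move=> e we; rewrite -lee_fin fineK//; apply: stab; rewrite lte_fin.
Qed.
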